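(* Let $(\varepsilon_n)_{n\ge1}$ be any sequence in $(0,1)$ such that $n\varepsilon_n\to\infty$. Then \[\mathbb{P}\big(Z_n(0)>0 \text{ and } Z_n(\varepsilon_n)>0\big)-\mathbb{P}\big(Z_n(0)>0\big)^2\to 0 \quad\text{as } n\to\infty.\]
   Context: Let $(X_j^i)_{j\ge 1,\,i\ge 0}$ be i.i.d. random variables with $\mathbb{P}(X_j^i=1)=\mathbb{P}(X_j^i=-1)=1/2$, and let $(N_j(t),t\ge0)_{j\ge1}$ be independent rate-$1$ Poisson processes, independent of the $X_j^i$. Define $X_j(t)=X_j^i$ whenever $N_j(t)=i$. The dynamical switch random walk is $Z_n(t)=\sum_{k=1}^n\prod_{j=1}^k X_j(t)$ for $n\ge 0$, $t\ge0$. *)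

(* Defs.v *)
From HB Require Import structures.
From mathcomp Require Import all_boot all_order all_algebra.
From mathcomp Require Import all_classical all_reals all_analysis.
Set Implicit Arguments. Unset Strict Implicit. Unset Printing Implicit Defensive.
Import Order.TTheory GRing.Theory Num.Theory.
Import numFieldNormedType.Exports.
Local Open Scope classical_set_scope.
Local Open Scope ring_scope.

Definition pois_pmf {R : realType} (r : R) (k : nat) : R :=
  r ^+ k / (k`!)%:R * expR (- r).

(* Mutual independence of a family of "blocks" of real random variables:
   block i consists of the coordinates Y i c for the admissible indices c
   (ok i c).  The blocks (i.e. the sigma-algebras they generate) are mutually
   independent iff the probability of every finite-dimensional cylinder event
   factorizes over the blocks. *)
Definition indep_blocks d (T : measurableType d) (R : realType)
    (P : probability T R) (I : eqType) (C : eqType) (ok : I -> C -> Prop)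
    (Y : I -> C -> T -> R) : Prop :=
  forall (J : seq I) (cs : I -> seq C) (B : I -> C -> set R),
    uniq J ->
    (forall i c, c \in cs i -> ok i c) ->
    (forall i c, measurable (B i c)) ->
    P (\bigcap_(i in [set` J]) \bigcap_(c in [set` cs i]) (Y i c @^-1` B i c))
    = (\prod_(i <- J) P (\bigcap_(c in [set` cs i]) (Y i c @^-1` B i c)))%E.

Definition poisson_process d (T : measurableType d) (R : realType)
    (P : probability T R) (N : R -> T -> nat) : Prop :=
  [/\ forall t, 0 <= t -> measurable_fun setT (fun w => (N t w)%:R : R),
      forall w, N 0 w = 0%N,
      forall w s t, 0 <= s -> s <= t -> (N s w <= N t w)%N &
      forall (m : nat) (t : nat -> R) (k : nat -> nat),
        0 <= t 0%N -> (forall i, (i < m)%N -> t i < t i.+1) ->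
        P (\bigcap_(i in [set i | (i < m)%N])
             [set w | (N (t i.+1) w - N (t i) w)%N = k i])
        = (\prod_(0 <= i < m) (pois_pmf (t i.+1 - t i) (k i))%:E)%E].

Definition sw_blocks d (T : measurableType d) (R : realType)
    (X : nat -> nat -> T -> R) (N : nat -> R -> T -> nat)
    (b : (nat * nat)%type + nat) (c : R) : T -> R :=
  match b with
  | inl ji => X ji.1 ji.2
  | inr j => fun w => (N j c w)%:R
  end.

Definition sw_ok {R : realType} (b : (nat * nat)%type + nat) (c : R) : Prop :=
  match b with inl _ => True | inr _ => 0 <= c end.

Definition switch_model d (T : measurableType d) (R : realType)
    (P : probability T R) (X : nat -> nat -> T -> R) (N : nat -> R -> T -> nat)
    : Prop :=
  [/\ forall j i, measurable_fun setT (X j i),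
      forall j i, P [set w | X j i w = 1] = (1/2 : R)%:E,
      forall j i, P [set w | X j i w = -1] = (1/2 : R)%:E,
      forall j, poisson_process P (N j) &
      indep_blocks P (@sw_ok R) (sw_blocks X N)].

Definition Xt d (T : measurableType d) (R : realType)
    (X : nat -> nat -> T -> R) (N : nat -> R -> T -> nat)
    (j : nat) (t : R) (w : T) : R := X j (N j t w) w.

Definition Zsw d (T : measurableType d) (R : realType)
    (X : nat -> nat -> T -> R) (N : nat -> R -> T -> nat)
    (n : nat) (t : R) (w : T) : R :=
  \sum_(1 <= k < n.+1) \prod_(1 <= j < k.+1) Xt X N j t w.

(* Main.v *)
Require Import Defs.
From HB Require Import structures.
From mathcomp Require Import all_boot all_order all_algebra.
From mathcomp Require Import all_classical all_reals all_analysis.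
From mathcomp Require Import zify ring lra.
Set Implicit Arguments. Unset Strict Implicit. Unset Printing Implicit Defensive.
Import Order.TTheory GRing.Theory Num.Theory.
Import numFieldNormedType.Exports.
Local Open Scope classical_set_scope.
Local Open Scope ring_scope.

(* The steps of [Z_n(0)] are i.i.d. signs [W_k], and those of [Z_n(eps)] are
   [W_k D_k] where [D] is an independent sign chain which keeps its value with
   probability [(1 + exp (- eps)) / 2].  Given [D], let [A] and [B] be the sums of
   the [W_k] with [D_k = 1] and with [D_k = -1]: they are independent simple random
   walks of lengths [m] and [l], [m + l = n], and the event is [A > |B|].  By
   symmetry its probability is 1/4 up to a tie term of order [1 / sqrt n] and to
   [(P(|A| > |B|) - P(|B| > |A|)) / 4].  Exchanging [min(m, l)] steps of [A] and [B]
   bounds this difference by the probability that a walk of length [2 min(m, l)] is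
   dominated by one of length [|m - l|], which is small as soon as [|m - l|] is
   small compared to [n].  This happens with high probability since the
   second moment of [sum_k D_k] is of order [n / eps = n^2 / (n eps)]. *)

(** * Expectations over a simple random walk, by conditioning on the first step *)

Fixpoint walkE {R : realType} (m : nat) (f : int -> R) : R :=
  if m is m'.+1 then
    (walkE m' (fun x => f (x + 1)) + walkE m' (fun x => f (x - 1))) / 2
  else f 0.

Lemma walkED (R : realType) m (f g : int -> R) :
  walkE m (fun x => f x + g x) = walkE m f + walkE m g.
Proof. by elim: m f g => [//|m IH] f g /=; rewrite !IH; field. Qed.

Lemma walkEZ (R : realType) m (c : R) (f : int -> R) :
  walkE m (fun x => c * f x) = c * walkE m f.
Proof. by elim: m f => [//|m IH] f /=; rewrite !IH; field. Qed.

Lemma walkE_cst (R : realType) m (c : R) : walkE m (fun=> c) = c.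
Proof. by elim: m => [//|m IH] /=; rewrite IH; field. Qed.

Lemma walkEB (R : realType) m (f g : int -> R) :
  walkE m (fun x => f x - g x) = walkE m f - walkE m g.
Proof. by elim: m f g => [//|m IH] f g /=; rewrite !IH; field. Qed.

Lemma eq_walkE (R : realType) m (f g : int -> R) :
  f =1 g -> walkE m f = walkE m g.
Proof. by move=> /funext ->. Qed.

Lemma le_walkE (R : realType) m (f g : int -> R) :
  (forall x, f x <= g x) -> walkE m f <= walkE m g.
Proof.
elim: m f g => [|m IH] f g fg /=; first exact: fg.
by rewrite ler_pM2r ?invr_gt0// lerD// IH.
Qed.

Lemma norm_walkE (R : realType) m (f : int -> R) :
  `|walkE m f| <= walkE m (fun x => `|f x|).
Proof.
elim: m f => [//|m IH] f /=.
rewrite normrM [`|2^-1|]ger0_norm ?invr_ge0// ler_pM2r ?invr_gt0//.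
by rewrite (le_trans (ler_normD _ _))// lerD.
Qed.

Lemma walkE_sum (R : realType) m (I : Type) (s : seq I) (f : I -> int -> R) :
  walkE m (fun x => \sum_(i <- s) f i x) = \sum_(i <- s) walkE m (f i).
Proof.
elim: s => [|i s IH].
  by rewrite big_nil -[RHS](walkE_cst m); apply: eq_walkE => x; rewrite big_nil.
rewrite big_cons -IH -walkED; apply: eq_walkE => x.
by rewrite big_cons.
Qed.

Lemma walkE_swap (R : realType) m l (f : int -> int -> R) :
  walkE m (fun x => walkE l (fun y => f x y)) =
  walkE l (fun y => walkE m (fun x => f x y)).
Proof.
elim: m f => [//|m IH] f /=.
rewrite !IH -walkED mulrC -walkEZ; apply: eq_walkE => y; exact: mulrC.
Qed.

Lemma walkE_addn (R : realType) m k (f : int -> R) :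
  walkE (m + k) f = walkE m (fun x => walkE k (fun y => f (x + y))).
Proof.
elim: m f => [|m IH] f /=; first by apply: eq_walkE => y; rewrite add0r.
rewrite !IH; congr ((_ + _) / _); apply: eq_walkE => x; apply: eq_walkE => y;
  congr f; lia.
Qed.

Lemma walkE_opp (R : realType) m (f : int -> R) :
  walkE m (fun x => f (- x)) = walkE m f.
Proof.
elim: m f => [|m IH] f /=; first by rewrite oppr0.
rewrite addrC -(IH (fun x => f (x + 1))) -(IH (fun x => f (x - 1))).
by congr ((_ + _) / _); apply: eq_walkE => x; congr f; lia.
Qed.

Lemma walkE_sqr (R : realType) m :
  walkE m (fun x => x%:~R ^+ 2) = m%:R :> R.
Proof.
(* The starting point [a] is generalized so that the induction passes through a step: the cross
   terms of [a + 1] and [a - 1] cancel and each step adds 1. *)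
suff H : forall a : int, walkE m (fun x => (x + a)%:~R ^+ 2) =
    m%:R + a%:~R ^+ 2 :> R.
  rewrite -[RHS]addr0 -[X in _ + X](expr0n R 2) -[0 in RHS](mulr0z 1) -H.
  by apply: eq_walkE => x; rewrite addr0.
elim: m => [|m IH] a /=; first by rewrite !add0r.
have E b : walkE m (fun x => (x + b + a)%:~R ^+ 2) = m%:R + (b + a)%:~R ^+ 2 :> R.
  by rewrite -IH; apply: eq_walkE => x; rewrite addrA.
by rewrite !E !intrD -natr1 /= mulrN1z; field.
Qed.

(** * Point probabilities of the walk *)

Lemma walkE_shift (R : realType) m (x c : int) :
  walkE m (fun z => (z + c == x)%:R) = walkE m (fun z => (z == x - c)%:R) :> R.
Proof. by apply: eq_walkE => z; congr (nat_of_bool _)%:R; lia. Qed.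

(** Only the sites below [- m] are treated: above [m], [walkE_bin] gives 0 through a vanishing
    binomial coefficient. *)
Lemma walkE_out (R : realType) m (x : int) : x < - m%:Z ->
  walkE m (fun z => (z == x)%:R) = 0 :> R.
Proof.
elim: m x => [|m IH] x xm /=; first by have -> : (0 == x) = false by lia.
rewrite (@walkE_shift R m x 1) (@walkE_shift R m x (-1)) !IH; [by field|lia|lia].
Qed.

(** After [m] steps the walk has the parity of [m]. *)
Lemma walkE_odd (R : realType) m (k : int) :
  walkE m (fun z => (z == k * 2 + 1 - m%:Z)%:R) = 0 :> R.
Proof.
elim: m k => [|m IH] k /=.
  by have -> : (0 == k * 2 + 1 - 0) = false by lia.
rewrite walkE_shift (@walkE_shift R m _ (-1)).
have -> : k * 2 + 1 - m.+1%:Z - 1 = (k - 1) * 2 + 1 - m%:Z by lia.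
have -> : k * 2 + 1 - m.+1%:Z - -1 = k * 2 + 1 - m%:Z by lia.
by rewrite !IH; field.
Qed.

Lemma walkE_bin (R : realType) m (k : nat) :
  walkE m (fun z => (z == k%:Z * 2 - m%:Z)%:R) = 'C(m, k)%:R / 2 ^+ m :> R.
Proof.
elim: m k => [|m IH] k /=.
  rewrite expr0 divr1 bin0n; congr (nat_of_bool _)%:R; lia.
rewrite walkE_shift (@walkE_shift R m _ (-1)).
have -> : k%:Z * 2 - m.+1%:Z - -1 = k%:Z * 2 - m%:Z by lia.
rewrite IH; case: k => [|k].
  by rewrite walkE_out ?bin0 ?exprS; [field; rewrite expf_neq0|lia].
have -> : k.+1%:Z * 2 - m.+1%:Z - 1 = k%:Z * 2 - m%:Z by lia.
by rewrite IH binS natrD exprS; field; rewrite expf_neq0.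
Qed.

(** Below the centre, [(j + 1) C(2m, j + 1) = (2m - j) C(2m, j)] with [2m - j >= j + 1], so the
    coefficients increase up to [m]; the other half follows by symmetry. *)
Lemma bin_le_central m k : ('C(m.*2, k) <= 'C(m.*2, m))%N.
Proof.
have up j : (j < m)%N -> ('C(m.*2, j) <= 'C(m.*2, j.+1))%N.
  move=> jm; rewrite -(leq_pmul2l (ltn0Sn j)).
  by rewrite mul_bin_left leq_mul2r; apply/orP; right; lia.
have low j : (j <= m)%N -> ('C(m.*2, j) <= 'C(m.*2, m))%N.
  move=> jm; rewrite -(subKn jm); move: (m - j)%N (leq_subr j m) => i.
  elim: i => [|i IH] im; first by rewrite subn0.
  apply: leq_trans (IH (ltnW im)).
  have -> : (m - i = (m - i.+1).+1)%N by lia.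
  by apply: up; lia.
have [km|mk] := leqP k m; first exact: low.
have [km2|m2k] := leqP k m.*2; last by rewrite bin_small.
by rewrite -bin_sub//; apply: low; lia.
Qed.

(** Induction through [(m + 1) C(2m + 2, m + 1) = 2 (2m + 1) C(2m, m)] and
    [(2m + 1)(2m + 3) <= (2m + 2)^2]. The factor [2m + 1], rather than [2m], lets one bound serve
    the times [2m] and [2m + 1]. *)
Lemma central_bin_sqr m : ('C(m.*2, m) ^ 2 * m.*2.+1 <= 16 ^ m)%N.
Proof.
elim: m => [//|m IH].
have E : (m.+1 * 'C(m.+1.*2, m.+1) = 2 * (m.*2.+1 * 'C(m.*2, m)))%N.
  rewrite doubleS.
  have := mul_bin_diag m.*2.+2 m; have := mul_bin_down m.*2.+1 m => /=.
  have -> : (m.*2.+1 - m = m.+1)%N by lia.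
  by nia.
rewrite -(@leq_pmul2l (m.+1 ^ 2))// mulnA -expnMn E.
have -> : ((2 * (m.*2.+1 * 'C(m.*2, m))) ^ 2 * m.+1.*2.+1 =
  4 * m.*2.+1 * m.+1.*2.+1 * ('C(m.*2, m) ^ 2 * m.*2.+1))%N by lia.
have -> : (m.+1 ^ 2 * 16 ^ m.+1 = (16 * m.+1 ^ 2) * 16 ^ m)%N.
  by rewrite (expnS 16) mulnA (mulnC _ 16)%N.
apply: leq_mul => //; nia.
Qed.

(** Each new point probability is the mean of two old ones. *)
Lemma walkE_le_succ (R : realType) m (c : R) :
  (forall x, walkE m (fun z => (z == x)%:R) <= c) ->
  forall x, walkE m.+1 (fun z => (z == x)%:R) <= c.
Proof.
move=> mc x /=; rewrite walkE_shift (@walkE_shift R m _ (-1)).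
have := mc (x - 1); have := mc (x - -1); lra.
Qed.

Lemma walkE_even_le (R : realType) m (x : int) :
  walkE m.*2 (fun z => (z == x)%:R) <= (Num.sqrt m.*2.+1%:R)^-1 :> R.
Proof.
have bin_le k : 'C(m.*2, k)%:R / 2 ^+ m.*2 <= (Num.sqrt m.*2.+1%:R)^-1 :> R.
  rewrite -[leLHS]ger0_norm ?divr_ge0 ?exprn_ge0// -sqrtr_sqr -sqrtrV ?ler0n//.
  rewrite ler_sqrt ?invr_ge0 ?ler0n// expr_div_n -ler_pdivlMr; last first.
    by rewrite invr_gt0 exprn_gt0// exprn_gt0.
  rewrite invrK ler_pdivlMl ?ltr0n//.
  apply: (@le_trans _ _ ('C(m.*2, m) ^ 2 * m.*2.+1)%:R).
    by rewrite mulrC -natrX -natrM ler_nat leq_mul2r leq_exp2r ?bin_le_central ?orbT.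
  rewrite -exprM -mul2n -natrX ler_nat.
  by rewrite mulnAC expnM mul2n; exact: central_bin_sqr.
have [xm|mx] := ltrP x (- m.*2%:Z); first by rewrite walkE_out// invr_ge0 sqrtr_ge0.
have [k xk] : exists k : nat, x + m.*2%:Z = k%:Z.
  by exists (absz (x + m.*2%:Z)); lia.
have {xk}-> : x = k%:Z - m.*2%:Z by lia.
rewrite -(odd_double_half k); case: (odd k) => /=.
  have -> : (1 + k./2.*2)%N%:Z - m.*2%:Z = k./2%:Z * 2 + 1 - m.*2%:Z by lia.
  by rewrite walkE_odd invr_ge0 sqrtr_ge0.
have -> : (0 + k./2.*2)%N%:Z - m.*2%:Z = k./2%:Z * 2 - m.*2%:Z by lia.
by rewrite walkE_bin.
Qed.

Lemma walkE_point_le (R : realType) n (x : int) : (0 < n)%N ->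
  walkE n (fun z => (z == x)%:R) <= (Num.sqrt n%:R)^-1 :> R.
Proof.
move=> n0; rewrite -(odd_double_half n); set m := n./2.
have le2 : walkE m.*2 (fun z => (z == x)%:R) <= (Num.sqrt m.*2.+1%:R)^-1 :> R.
  exact: walkE_even_le.
case on : (odd n) => /=.
  by apply: walkE_le_succ => y; exact: walkE_even_le.
rewrite add0n (le_trans le2)// lef_pV2 ?posrE ?sqrtr_gt0 ?ltr0n//; last first.
  by rewrite /m; move: on; case: n n0 @m {le2} => [|[|n]].
by rewrite ler_wsqrtr// ler_nat.
Qed.

Lemma walkE_norm_le (R : realType) n (c : nat) : (0 < n)%N ->
  walkE n (fun z => (`|z| <= c%:Z)%R%:R) <= (2 * c%:R + 1) / Num.sqrt n%:R :> R.
Proof.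
move=> n0.
(* Union bound over the [2c + 1] sites of [[-c, c]]. *)
apply: (@le_trans _ _ (walkE n (fun z =>
    \sum_(i < (2 * c).+1) (z == i%:Z - c%:Z)%:R))).
  apply: le_walkE => z.
  have [zc|_] := lerP `|z| c%:Z; last by rewrite sumr_ge0.
  have lt : ((absz (z + c%:Z)%R) < (2 * c).+1)%N by lia.
  rewrite (bigD1 (Ordinal lt))//=.
  have -> : z == (absz (z + c%:Z)%R)%:Z - c%:Z by apply/eqP; lia.
  by rewrite lerDl sumr_ge0.
rewrite walkE_sum (@le_trans _ _ (\sum_(i < (2 * c).+1) (Num.sqrt n%:R)^-1))//.
  by apply: ler_sum => i _; exact: walkE_point_le.
by rewrite sumr_const card_ord -[leLHS]mulr_natl -natr1 natrM.
Qed.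

(** * Two independent walks and the comparison of their absolute values *)

Definition walkE2 {R : realType} (m l : nat) (f : int -> int -> R) : R :=
  walkE m (fun a => walkE l (f a)).

Lemma walkE2D (R : realType) m l (f g : int -> int -> R) :
  walkE2 m l (fun a b => f a b + g a b) = walkE2 m l f + walkE2 m l g.
Proof. by rewrite -walkED; apply: eq_walkE => a; exact: walkED. Qed.

Lemma walkE2B (R : realType) m l (f g : int -> int -> R) :
  walkE2 m l (fun a b => f a b - g a b) = walkE2 m l f - walkE2 m l g.
Proof. by rewrite -walkEB; apply: eq_walkE => a; exact: walkEB. Qed.

Lemma eq_walkE2 (R : realType) m l (f g : int -> int -> R) :
  f =2 g -> walkE2 m l f = walkE2 m l g.
Proof. by move=> fg; apply: eq_walkE => a; apply: eq_walkE. Qed.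

Lemma le_walkE2 (R : realType) m l (f g : int -> int -> R) :
  (forall a b, f a b <= g a b) -> walkE2 m l f <= walkE2 m l g.
Proof. by move=> fg; apply: le_walkE => a; apply: le_walkE. Qed.

Lemma walkE2_cst (R : realType) m l (c : R) : walkE2 m l (fun _ _ => c) = c.
Proof. by rewrite /walkE2 !walkE_cst. Qed.

Lemma norm_walkE2 (R : realType) m l (f : int -> int -> R) :
  `|walkE2 m l f| <= walkE2 m l (fun a b => `|f a b|).
Proof.
by rewrite (le_trans (norm_walkE _ _))//; apply: le_walkE => a; exact: norm_walkE.
Qed.

Lemma walkE2_add (R : realType) m l (f : int -> R) :
  walkE2 m l (fun a b => f (a + b)) = walkE (m + l) f.
Proof. by rewrite walkE_addn. Qed.

Lemma walkE2_sub (R : realType) m l (f : int -> R) :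
  walkE2 m l (fun a b => f (a - b)) = walkE (m + l) f.
Proof.
rewrite walkE_addn; apply: eq_walkE => a.
exact: (walkE_opp l (fun b => f (a + b))).
Qed.

(** This is the sign of [|a| - |b|]; its antisymmetry makes equal lengths give expectation 0. *)
Definition dominance {R : realType} (a b : int) : R :=
  (`|b| < `|a|)%R%:R - (`|a| < `|b|)%R%:R.

Lemma walkE2_dominanceC (R : realType) m l :
  walkE2 m l dominance = - walkE2 l m dominance :> R.
Proof.
rewrite /walkE2 walkE_swap -mulN1r -walkEZ; apply: eq_walkE => b.
rewrite -walkEZ; apply: eq_walkE => a; rewrite /dominance; ring.
Qed.

Lemma norm_dominance_le1 (R : realType) m l :
  `|walkE2 m l dominance| <= 1 :> R.
Proof.
rewrite (le_trans (norm_walkE2 _ _ _))// -[leRHS](walkE2_cst m l).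
apply: le_walkE2 => a b; rewrite /dominance.
by case: ltrgtP => _ /=; rewrite ?subrr ?subr0 ?sub0r ?normrN ?normr0 ?normr1.
Qed.

(* Write the longer walk as [b + c] with [a], [b] of the same length and
   exchange [a] and [b]: the two signs cancel unless [|a - b| <= |c|]. *)
Lemma dominance_exchange (R : realType) m k :
  `|walkE2 m (m + k) dominance| <=
  walkE k (fun c => walkE m.*2 (fun s => (`|s| <= (absz c)%:Z)%R%:R)) :> R.
Proof.
pose F (f : int -> int -> int -> R) :=
  walkE m (fun a => walkE m (fun b => walkE k (f a b))).
have dE : walkE2 m (m + k) dominance = F (fun a b c => dominance a (b + c)) :> R.
  by apply: eq_walkE => a; rewrite walkE_addn.
have dE' : walkE2 m (m + k) dominance = F (fun a b c => dominance b (a + c)) :> R.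
  by rewrite dE /F walkE_swap.
have FD f g : F (fun a b c => f a b c + g a b c) = F f + F g.
  rewrite /F -walkED; apply: eq_walkE => a; rewrite -walkED.
  by apply: eq_walkE => b; rewrite walkED.
have -> : walkE k (fun c => walkE m.*2 (fun s => (`|s| <= (absz c)%:Z)%R%:R)) =
    F (fun a b c => (`|a - b| <= (absz c)%:Z)%R%:R).
  rewrite walkE_swap -addnn -(walkE2_sub m m (fun s => walkE k
    (fun c => (`|s| <= (absz c)%:Z)%R%:R))).
  by [].
(* The left-hand side is doubled so that the expressions [dE] and [dE'] can be added. *)
rewrite -(@ler_pM2l _ 2)// -[2 in leLHS]ger0_norm// -normrM.
rewrite mulr_natl mulr2n {1}dE dE' -FD mulr_natl mulr2n -FD.
rewrite /F (le_trans (norm_walkE _ _))//; apply: le_walkE => a.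
rewrite (le_trans (norm_walkE _ _))//; apply: le_walkE => b.
rewrite (le_trans (norm_walkE _ _))//; apply: le_walkE => c.
rewrite /dominance.
(* When [|a - b| <= |c|], the trivial bound 2 suffices. Otherwise
   [a^2 - (b + c)^2 = (a - b - c)(a + b + c)] and [b^2 - (a + c)^2 = (b - a - c)(a + b + c)] have
   opposite signs, or both vanish. *)
have [ab|ab] := lerP `|a - b| (absz c)%:Z.
  by case: ltrgtP => _ /=; case: ltrgtP => _ /=; rewrite ler_norml; apply/andP; split; lra.
case: ltrgtP => ? /=; case: ltrgtP => ? /=; try lia;
  by rewrite ?subrr ?subr0 ?sub0r ?addr0 ?addNr ?subrr ?normr0.
Qed.

(** With [n = 2m + k], the difference walk has length [2m >= n / 2], hence spread of order [sqrt n],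
    whereas the extra walk has second moment [k <= (t sqrt n)^2]. *)
Lemma dominance_le (R : realType) m k (t : R) : (0 < m)%N -> 0 < t ->
  k%:R <= t ^+ 2 * (m + (m + k))%:R -> t ^+ 2 <= 1 / 2 ->
  `|walkE2 m (m + k) dominance| <= 4 * t + 2 / Num.sqrt (m + (m + k))%:R.
Proof.
move=> m0 t0 kt t2; set n := (m + (m + k))%N; set r := Num.sqrt n%:R.
have r0 : 0 < r by rewrite sqrtr_gt0 ltr0n /n; lia.
have r2 : r ^+ 2 = n%:R by rewrite sqr_sqrtr.
have tr0 : 0 < t * r by rewrite mulr_gt0.
have half : (Num.sqrt m.*2%:R)^-1 <= 2 / r.
  rewrite -[leRHS]invrK lef_pV2 ?posrE ?sqrtr_gt0 ?ltr0n ?double_gt0//; last first.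
    by rewrite invr_gt0 divr_gt0.
  rewrite invf_div ler_pdivrMr// -[leRHS]ger0_norm ?mulr_ge0 ?sqrtr_ge0//.
  rewrite -sqrtr_sqr ler_wsqrtr// exprMn sqr_sqrtr//.
  have : n%:R = m.*2%:R + k%:R :> R by rewrite -natrD /n; congr (_%:R); lia.
  have : k%:R <= 1 / 2 * n%:R :> R by rewrite (le_trans kt)// ler_wpM2r.
  have := ler0n R n; lra.
rewrite (le_trans (dominance_exchange _ _ _))//.
(* The linear term is traded for the computable second moment by [2 |c| <= c^2 / (t r) + t r]. *)
apply: (@le_trans _ _ (walkE k (fun c =>
    (t * r + 1) * (2 / r) + (2 / r) * (t * r)^-1 * c%:~R ^+ 2))).
  apply: le_walkE => c.
  rewrite (le_trans (walkE_norm_le _ _ _)) ?double_gt0//.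
  apply: (@le_trans _ _ ((2 * (absz c)%:R + 1) * (2 / r))).
    by rewrite ler_pM2l// ltr_wpDl// mulr_ge0.
  have -> : c%:~R ^+ 2 = (absz c)%:R ^+ 2 :> R.
    by rewrite -natrX -abszX -[RHS]/((absz (c ^+ 2))%:Z%:~R) gez0_abs ?sqr_ge0// rmorphXn.
  set x := (absz c)%:R.
  have : 0 <= (x - t * r) ^+ 2 / (t * r) by rewrite divr_ge0 ?sqr_ge0// ltW.
  have -> : (x - t * r) ^+ 2 / (t * r) = x ^+ 2 * (t * r)^-1 - 2 * x + t * r.
    by field; rewrite !gt_eqF.
  have : 0 <= 2 / r by rewrite divr_ge0// ltW.
  move: (2 / r) (t * r)^-1 => w q w0 h; rewrite -subr_ge0.
  rewrite [leRHS](_ : _ = w * (x ^+ 2 * q - 2 * x + t * r)); last by ring.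
  exact: mulr_ge0.
rewrite walkED walkE_cst walkEZ walkE_sqr.
have -> : 4 * t = t * r * (2 / r) + (2 / r) * (t * r) by field; rewrite gt_eqF.
have : (t * r)^-1 * k%:R <= t * r by rewrite ler_pdivrMl// -expr2 exprMn r2.
have : 0 <= 2 / r by rewrite divr_ge0// ltW.
move: (2 / r) (t * r)^-1 => w q w0 h; rewrite -subr_ge0.
rewrite [leRHS](_ : _ = w * (t * r - q * k%:R)); last by ring.
by rewrite mulr_ge0// subr_ge0.
Qed.

(** * The quadrant probability for given lengths of the two walks *)

Definition quadrant {R : realType} (x y : int) : R := ((0 < x) && (0 < y))%R%:R.

(** The event is [a > |b|], half of [|a| > |b|] by the symmetry of [a]. Hence [4 U - 1] is the
    expected dominance minus the tie probability. A tie forces [a + b = 0] or [a - b = 0], and both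
    are walks of length [m + l]. *)
Lemma walkE2_quadrant (R : realType) m l : (0 < m + l)%N ->
  `|4 * walkE2 m l (fun a b => quadrant (a + b) (a - b)) - 1| <=
  `|walkE2 m l dominance| + 2 / Num.sqrt (m + l)%:R :> R.
Proof.
move=> ml0; set U := walkE2 m l _; set r := Num.sqrt _.
pose lt (a b : int) : R := (`|b| < `|a|)%R%:R.
pose tie (a b : int) : R := (`|a| == `|b|)%:R.
have U2 : 2 * U = walkE2 m l lt.
  have UN : U = walkE2 m l (fun a b => quadrant (- a + b) (- a - b)).
    by rewrite /U /walkE2 -(walkE_opp m).
  rewrite mulr_natl mulr2n {2}UN -walkE2D; apply: eq_walkE2 => a b.
  rewrite /quadrant /lt -natrD; congr (_%:R); lia.
have U3 : 1 = walkE2 m l lt + walkE2 l m lt + walkE2 m l tie.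
  rewrite -[in RHS](_ : walkE2 m l (fun a b => lt b a) = walkE2 l m lt); last first.
    exact: walkE_swap.
  rewrite -!walkE2D -[LHS](walkE2_cst m l); apply: eq_walkE2 => a b.
  by rewrite /lt /tie; case: ltrgtP => _ /=; ring.
have dE : walkE2 m l dominance = walkE2 m l lt - walkE2 l m lt.
  rewrite -(_ : walkE2 m l (fun a b => lt b a) = walkE2 l m lt); last first.
    exact: walkE_swap.
  by rewrite -walkE2B.
have tie0 : 0 <= walkE2 m l tie.
  by rewrite -(walkE2_cst m l 0); apply: le_walkE2 => a b; exact: ler0n.
have tie2 : walkE2 m l tie <= 2 / r.
  apply: (@le_trans _ _ (walkE2 m l (fun a b => (a + b == 0)%:R + (a - b == 0)%:R))).
    apply: le_walkE2 => a b; rewrite /tie -natrD ler_nat; lia.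
  rewrite walkE2D (walkE2_add m l (fun z => (z == 0)%:R)).
  rewrite (walkE2_sub m l (fun z => (z == 0)%:R)).
  by rewrite mulr_natl mulr2n lerD ?walkE_point_le.
have -> : 4 * U - 1 = walkE2 m l dominance - walkE2 m l tie by rewrite dE; lra.
rewrite (le_trans (ler_normB _ _))// lerD2l ger0_norm//.
Qed.

Lemma walkE_pos (R : realType) n : (0 < n)%N ->
  `|walkE n (fun z => (0 < z)%R%:R) - 1 / 2| <= 1 / 2 / Num.sqrt n%:R :> R.
Proof.
move=> n0; set p := walkE n _.
have pN : p = walkE n (fun z => (z < 0)%R%:R).
  rewrite /p -(walkE_opp n); apply: eq_walkE => z; congr (nat_of_bool _)%:R; lia.
have p1 : 2 * p + walkE n (fun z => (z == 0)%:R) = 1.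
  rewrite mulr_natl mulr2n {2}pN -!walkED -[RHS](walkE_cst n).
  by apply: eq_walkE => z; case: ltrgtP => _ /=; ring.
have := @walkE_point_le R n 0 n0.
have : 0 <= walkE n (fun z => (z == 0)%:R) :> R.
  by rewrite -(walkE_cst n 0); apply: le_walkE => z; exact: ler0n.
rewrite ler_norml => ? ?; apply/andP; split; lra.
Qed.

(** A pointwise form of Chebyshev's inequality, ready to be averaged over [m] and [l]: if
    [|m - l| >= t^2 (m + l)], the last term is at least 1 and the trivial bound is enough; otherwise
    [dominance_le] applies. *)
Lemma quadrant_le (R : realType) m l (t : R) : (0 < m + l)%N -> 0 < t ->
  t ^+ 2 <= 1 / 2 ->
  `|walkE2 m l (fun a b => quadrant (a + b) (a - b)) - 1 / 4| <=
  t + (Num.sqrt (m + l)%:R)^-1 + (m%:R - l%:R) ^+ 2 / (t ^+ 4 * (m + l)%:R ^+ 2).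
Proof.
move=> n0 t0 t2; set r := (Num.sqrt (m + l)%:R)^-1.
set e := (m%:R - l%:R) ^+ 2 / _; set U := walkE2 _ _ _.
have r0 : 0 <= r by rewrite invr_ge0 sqrtr_ge0.
have den0 : 0 < t ^+ 4 * (m + l)%:R ^+ 2 by rewrite mulr_gt0 ?exprn_gt0 ?ltr0n.
have e0 : 0 <= e by rewrite divr_ge0 ?sqr_ge0 ?ltW.
have main : `|walkE2 m l dominance| <= 4 * t + 2 * r + e.
  have [big|small] := lerP (t ^+ 2 * (m + l)%:R) `|m%:R - l%:R|.
    have : 1 <= e.
      rewrite ler_pdivlMr// mul1r -[leRHS]real_normK ?num_real//.
      have -> : t ^+ 4 * (m + l)%:R ^+ 2 = (t ^+ 2 * (m + l)%:R) ^+ 2 by ring.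
      by rewrite ler_sqr ?nnegrE// mulr_ge0 ?sqr_ge0.
    have := norm_dominance_le1 R m l; lra.
  suff : `|walkE2 m l dominance| <= 4 * t + 2 * r by lra.
  (* The strict inequality makes the shorter length positive, as [dominance_le] requires. *)
  have lt_n : `|m%:R - l%:R| < (m + l)%:R :> R.
    rewrite (lt_le_trans small)// ler_piMl//; lra.
  wlog lem : m l n0 @r {U e r0 den0 e0} small lt_n / (m <= l)%N.
    have [lem|lm] := leqP m l; first exact.
    move=> /(_ l m); rewrite (addnC l) (distrC l%:R) walkE2_dominanceC normrN.
    by apply=> //; exact: ltnW.
  rewrite /r -(subnKC lem) dominance_le//.
  - move: lt_n; rewrite distrC -natrB// normr_nat ltr_nat; lia.
  - by move: small; rewrite subnKC// distrC -natrB// normr_nat => /ltW.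
have := le_trans (walkE2_quadrant R n0) (lerD main (lexx _)).
rewrite -/U -/r !ler_norml => /andP[? ?]; apply/andP; split; lra.
Qed.

(** * The chain of relative signs and its second moment *)

(* The chain of signs [D_1, D_2, ...] with [D_0 = (-1)^d], which keeps its sign
   with probability [(1 + rho) / 2]; [f] is evaluated at the numbers of indices
   [1 <= k <= n] with [D_k = 1] and with [D_k = -1]. *)
Fixpoint chainE {R : realType} (rho : R) (n : nat) (d : bool)
    (f : nat -> nat -> R) : R :=
  if n is n'.+1 then
    let next d := chainE rho n' d
      (fun m l => if d then f m l.+1 else f m.+1 l) in
    (1 + rho) / 2 * next d + (1 - rho) / 2 * next (~~ d)
  else f 0%N 0%N.

Lemma eq_chainE (R : realType) (rho : R) n d (f g : nat -> nat -> R) :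
  f =2 g -> chainE rho n d f = chainE rho n d g.
Proof. by move=> fg; congr chainE; apply/funext => m; apply/funext. Qed.

Lemma chainED (R : realType) (rho : R) n d (f g : nat -> nat -> R) :
  chainE rho n d (fun m l => f m l + g m l) =
  chainE rho n d f + chainE rho n d g.
Proof.
elim: n d f g => [//|n IH] d f g /=.
by case: d => /=; rewrite !IH; ring.
Qed.

Lemma chainEZ (R : realType) (rho : R) n d (c : R) (f : nat -> nat -> R) :
  chainE rho n d (fun m l => c * f m l) = c * chainE rho n d f.
Proof.
by elim: n d f => [//|n IH] d f /=; case: d => /=; rewrite !IH; ring.
Qed.

Lemma chainE_cst (R : realType) (rho c : R) n d :
  chainE rho n d (fun _ _ => c) = c.
Proof. by elim: n d => [//|n IH] d /=; case: d => /=; rewrite !IH; field. Qed.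

Lemma le_chainE (R : realType) (rho : R) n d (f g : nat -> nat -> R) :
  0 <= rho <= 1 -> (forall m l, (m + l)%N = n -> f m l <= g m l) ->
  chainE rho n d f <= chainE rho n d g.
Proof.
move=> /andP[rho0 rho1]; elim: n d f g => [|n IH] d f g fg /=; first exact: fg.
have next b : chainE rho n b (fun m l => if b then f m l.+1 else f m.+1 l) <=
    chainE rho n b (fun m l => if b then g m l.+1 else g m.+1 l).
  by apply: IH => m l mln; case: b; apply: fg; lia.
by rewrite lerD// ler_wpM2l ?next// divr_ge0//; lra.
Qed.

(** Since [D_k] has mean [rho^k D_0], the witness is [s = rho + ... + rho^n], built by
    [s' = rho (1 + s)]. The bound on [(1 - rho) * s] avoids a division and so includes [rho = 1]. *)
Lemma chainE_diff (R : realType) (rho : R) n : 0 <= rho <= 1 ->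
  exists s : R, [/\ 0 <= s, (1 - rho) * s <= rho &
    forall d, chainE rho n d (fun m l => m%:R - l%:R) = (-1) ^+ d * s].
Proof.
move=> /andP[rho0 rho1]; elim: n => [|n [s [s0 sr sE]]].
  by exists 0; split=> // [|d]; rewrite ?mulr0//= subrr.
exists (rho * (1 + s)); split; [by rewrite mulr_ge0// addr_ge0|nra|].
have next (b : bool) : chainE rho n b
    (fun m l => if b then m%:R - l.+1%:R else m.+1%:R - l%:R) =
    (-1) ^+ b * (1 + s).
  rewrite mulrDr -sE mulr1 -[X in X + _](chainE_cst rho _ n b) -chainED.
  apply: eq_chainE => m l; case: b; rewrite -natr1 ?expr1 ?expr0; ring.
by move=> d /=; rewrite !next; case: d; rewrite /= ?expr1 ?expr0; field.
Qed.

(** Isolating the first sign, [(D_1 + S)^2 = S^2 + 1 + 2 D_1 S] with [D_1 S] of mean [s]. The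
    increment is [(1 - rho)(1 + 2 s) <= 1 + rho <= 2]. *)
Lemma chainE_sqr (R : realType) (rho : R) n d : 0 <= rho <= 1 ->
  (1 - rho) * chainE rho n d (fun m l => (m%:R - l%:R) ^+ 2) <= 2 * n%:R.
Proof.
move=> rho01; have /andP[rho0 rho1] := rho01; elim: n d => [|n IH] d.
  by rewrite /= subrr expr0n /= !mulr0.
have [s [s0 sr sE]] := chainE_diff n rho01.
have next (b : bool) : (1 - rho) * chainE rho n b (fun m l =>
      if b then (m%:R - l.+1%:R) ^+ 2 else (m.+1%:R - l%:R) ^+ 2) <=
    2 * n%:R + 2.
  have -> : chainE rho n b (fun m l =>
      if b then (m%:R - l.+1%:R) ^+ 2 else (m.+1%:R - l%:R) ^+ 2) =
      chainE rho n b (fun m l => (m%:R - l%:R) ^+ 2) + 1 + 2 * s.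
    have -> : 2 * s = 2 * (-1) ^+ b * ((-1) ^+ b * s).
      by case: b; rewrite ?expr1 ?expr0; ring.
    rewrite -sE -chainEZ -[X in _ + X + _](chainE_cst rho _ n b) -!chainED.
    apply: eq_chainE => m l; case: b; rewrite -natr1 ?expr1 ?expr0; ring.
  move: (IH b); move: (chainE _ _ _ _) => x hx; nra.
rewrite /= -(natr1 n).
move: (next d) (next (~~ d)); move: (chainE _ _ _ _) (chainE _ _ _ _) => x y hx hy.
have -> : 2 * (n%:R + 1) = (1 + rho) / 2 * (2 * n%:R + 2) +
    (1 - rho) / 2 * (2 * n%:R + 2) :> R by field.
by rewrite mulrDr lerD// mulrCA ler_wpM2l//; lra.
Qed.

(** * The joint evolution of the two walks *)

(** With [true] standing for -1, the product of signs becomes [(+)]. *)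
Definition bsign (b : bool) : int := if b then -1 else 1.

(** The law of two fair signs with correlation [rho]. *)
Definition pair_prob {R : realType} (rho : R) (ab : bool * bool) : R :=
  (if ab.1 == ab.2 then 1 + rho else 1 - rho) / 4.

Lemma walkE2Sl (R : realType) m l (f : int -> int -> R) :
  walkE2 m.+1 l f = (walkE2 m l (fun a b => f (a + 1) b) +
                     walkE2 m l (fun a b => f (a - 1) b)) / 2.
Proof. by []. Qed.

Lemma walkE2Sr (R : realType) m l (f : int -> int -> R) :
  walkE2 m l.+1 f = (walkE2 m l (fun a b => f a (b + 1)) +
                     walkE2 m l (fun a b => f a (b - 1))) / 2.
Proof.
rewrite /walkE2 /= -walkED mulrC -walkEZ; apply: eq_walkE => a; exact: mulrC.
Qed.

(* [w] and [w'] are the signs of the current steps of the two walks, and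
   [z] and [z'] their current positions. *)
Fixpoint pairE {R : realType} (rho : R) (F : int -> int -> R) (k : nat)
    (w w' : bool) (z z' : int) : R :=
  if k is k'.+1 then
    \sum_(ab : bool * bool) pair_prob rho ab *
      pairE rho F k' (w (+) ab.1) (w' (+) ab.2)
        (z + bsign (w (+) ab.1)) (z' + bsign (w' (+) ab.2))
  else F z z'.

Lemma big_bool2 (R : realType) (f : bool * bool -> R) :
  \sum_ab f ab =
  f (true, true) + f (true, false) + (f (false, true) + f (false, false)).
Proof.
have -> : \sum_ab f ab = \sum_(ab : bool * bool) f (ab.1, ab.2).
  by apply: eq_bigr => -[].
by rewrite -(pair_bigA _ (fun a b => f (a, b))) /= !big_bool.
Qed.

(** The relative sign [w (+) w'] is the chain, and given it the signs of the first walk remain fair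
    and independent. Steps with relative sign 1 add up to [a], the others to [b], so the walks end
    at [a + b] and [a - b]. *)
Lemma pairE_chainE (R : realType) (rho : R) F k w w' z z' :
  pairE rho F k w w' z z' =
  chainE rho k (w (+) w') (fun m l =>
    walkE2 m l (fun a b => F (z + (a + b)) (z' + (a - b)))).
Proof.
elim: k w w' z z' => [|k IH] w w' z z'.
  by rewrite /= /walkE2 /= subrr addr0 !addr0.
(* Given the next relative sign [d], the first walk moves by either sign with equal weight; [w1]
   only chooses the order of these two terms. *)
have next (d : bool) (w1 : bool) : chainE rho k d (fun m l =>
    if d then walkE2 m l.+1 (fun a b => F (z + (a + b)) (z' + (a - b)))
    else walkE2 m.+1 l (fun a b => F (z + (a + b)) (z' + (a - b)))) =
    (pairE rho F k w1 (w1 (+) d) (z + bsign w1) (z' + bsign (w1 (+) d)) +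
     pairE rho F k (~~ w1) (~~ w1 (+) d) (z + bsign (~~ w1))
       (z' + bsign (~~ w1 (+) d))) / 2.
  rewrite !IH !addKb -chainED mulrC -chainEZ; apply: eq_chainE => m l.
  rewrite mulrC; case: d; [rewrite walkE2Sr|rewrite walkE2Sl]; 
    case: w1 => /=; [rewrite [in RHS](addrC (walkE2 m l _))| |
      rewrite [in RHS](addrC (walkE2 m l _))|]; congr ((_ + _) / _);
    apply: eq_walkE2 => a b; congr F; rewrite /bsign; lia.
rewrite /= big_bool2 /pair_prob /=.
rewrite (next _ (w (+) true)) (next _ (w (+) false)).
by case: w; case: w' => /=; field.
Qed.

(** Both quantities are compared with 1/4: the first by averaging [quadrant_le] over the chain, the
    second because [p] is within [1 / (2 sqrt n)] of 1/2. *)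
Lemma pairE_quadrant (R : realType) (rho t : R) n : (0 < n)%N ->
  0 <= rho < 1 -> 0 < t -> t ^+ 2 <= 1 / 2 ->
  `|pairE rho quadrant n false false 0 0 -
    pairE rho (fun x _ => (0 < x)%R%:R) n false false 0 0 ^+ 2| <=
  t + 2 / Num.sqrt n%:R + 2 / (t ^+ 4 * ((1 - rho) * n%:R)).
Proof.
move=> n0 /andP[rho0 rho1] t0 t2.
have rho01 : 0 <= rho <= 1 by rewrite rho0 ltW.
set p := pairE rho (fun x _ => (0 < x)%R%:R) _ _ _ _ _.
have pE : p = walkE n (fun z => (0 < z)%R%:R).
  rewrite /p pairE_chainE -[RHS](chainE_cst rho _ n false).
  (* Two inequalities are used because [le_chainE], unlike [eq_chainE], provides [m + l = n]. *)
  apply/eqP; rewrite eq_le !le_chainE// => m l <-;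
    by rewrite -walkE2_add; apply: le_walkE2 => a b; rewrite add0r.
set r := Num.sqrt n%:R.
have r1 : 1 <= r by rewrite -sqrtr1 ler_wsqrtr// ler1n.
have hp := @walkE_pos R n n0.
rewrite -pE -/r in hp.
set q := pairE _ quadrant _ _ _ _ _.
set e := 2 / (_ * _).
have q14 : `|q - 1 / 4| <= t + r^-1 + e.
  pose U m l := walkE2 m l (fun a b => quadrant (a + b) (a - b)) : R.
  pose b m l := t + r^-1 + (t ^+ 4 * n%:R ^+ 2)^-1 * (m%:R - l%:R) ^+ 2.
  have qE : q = chainE rho n false U.
    by rewrite /q pairE_chainE; apply: eq_chainE => m l;
      apply: eq_walkE2 => x y; rewrite !add0r.
  have Ub m l : (m + l)%N = n -> `|U m l - 1 / 4| <= b m l.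
    move=> mln; have := @quadrant_le R m l t.
    by rewrite mln /b [_^-1 * _]mulrC; exact.
  have bE : chainE rho n false b <= t + r^-1 + e.
    rewrite chainED chainE_cst lerD2l chainEZ.
    have nn : 0 < n%:R :> R by rewrite ltr0n.
    have -> : e = (t ^+ 4 * n%:R ^+ 2)^-1 * (2 * n%:R / (1 - rho)).
      by rewrite /e; field; rewrite !gt_eqF// subr_gt0.
    rewrite ler_pM2l ?invr_gt0 ?mulr_gt0 ?exprn_gt0//.
    by rewrite ler_pdivlMr ?subr_gt0// mulrC chainE_sqr.
  have up : chainE rho n false U <= 1 / 4 + chainE rho n false b.
    rewrite -[1 / 4](chainE_cst rho _ n false) -chainED.
    by apply: le_chainE => // m l /Ub; rewrite ler_norml => /andP[]; lra.
  have low : 1 / 4 <= chainE rho n false U + chainE rho n false b.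
    rewrite -[leLHS](chainE_cst rho _ n false) -chainED.
    by apply: le_chainE => // m l /Ub; rewrite ler_norml => /andP[]; lra.
  by rewrite qE ler_norml; apply/andP; split; lra.
have p14 : `|p ^+ 2 - 1 / 4| <= r^-1.
  have -> : p ^+ 2 - 1 / 4 = (p - 1 / 2) * (p + 1 / 2) by field.
  rewrite normrM; have : `|p + 1 / 2| <= 3 / 2.
    move: hp; have : r^-1 <= 1 by rewrite invf_le1// (lt_le_trans _ r1).
    rewrite !ler_norml => ? /andP[? ?]; apply/andP; split; lra.
  have := normr_ge0 (p - 1 / 2); have := normr_ge0 (p + 1 / 2).
  have : 0 <= r^-1 by rewrite invr_ge0 (le_trans _ r1).
  nra.
have -> : q - p ^+ 2 = (q - 1 / 4) - (p ^+ 2 - 1 / 4) by ring.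
rewrite (le_trans (ler_normB _ _))//; lra.
Qed.

(** * From the switch model to products of pair laws *)

(** The [F i] need not cover [E]: equality of the masses makes the uncovered part null. This suits
    signs that take the values 1 and -1 only almost surely. *)
Lemma measure_fin_partition d (T : measurableType d) (R : realType)
    (P : probability T R) (I : finType) (A E : set T) (F : I -> set T) :
  measurable A -> measurable E -> (forall i, measurable (F i)) ->
  (forall i, F i `<=` E) -> trivIset setT F ->
  fine (P E) = \sum_i fine (P (F i)) ->
  fine (P (A `&` E)) = \sum_i fine (P (A `&` F i)).
Proof.
move=> mA mE mF FE tF PE.
have finU (G : I -> set T) : (forall i, measurable (G i)) -> trivIset setT G ->
    P (\bigcup_i G i) = (\sum_i fine (P (G i)))%:E.
  move=> mG tG; rewrite measure_fin_bigcup//; last exact: finite_finset.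
  rewrite (fsbigE (index_enum I)) ?index_enum_uniq//; last first.
    by move=> i _; rewrite mem_index_enum.
  rewrite -sumEFin; apply: eq_big => [i|i _]; first by rewrite in_setT.
  by rewrite fineK// fin_num_measure.
have mU : measurable (\bigcup_i F i).
  by apply: fin_bigcup_measurable => //; exact: finite_finset.
have UE : \bigcup_i F i `<=` E by move=> w [i _]; exact: FE.
have D0 : P (E `\` \bigcup_i F i) = 0%E.
  have -> : P (E `\` \bigcup_i F i) = (P E - P (E `&` \bigcup_i F i))%E.
    by apply: measureD => //; rewrite -ge0_fin_numE// fin_num_measure.
  rewrite (setIidr UE) finU// -PE fineK ?fin_num_measure// subee//.
  by rewrite fin_num_measure.
have -> : A `&` E = (A `&` \bigcup_i F i) `|` (A `&` (E `\` \bigcup_i F i)).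
  rewrite -setIUr; congr (_ `&` _).
  by rewrite setDE setUIr setUv setIT; apply/esym/setUidPr.
rewrite (_ : P _ = P (A `&` \bigcup_i F i)).
  rewrite setI_bigcupr (finU (fun i => A `&` F i))//=.
    by move=> i; exact: measurableI.
  exact: trivIset_setIl.
have mD : measurable (E `\` \bigcup_i F i) by exact: measurableD.
apply: measureU0; [exact: measurableI|exact: measurableI|].
by apply: subset_measure0 D0 => //; exact: measurableI.
Qed.

Section SwitchModel.
Context d (T : measurableType d) (R : realType) (P : probability T R)
  (X : nat -> nat -> T -> R) (N : nat -> R -> T -> nat) (s : R).
Hypotheses (XN : switch_model P X N) (s0 : 0 < s).

Let sgn (b : bool) : R := (bsign b)%:~R.

Let mX j i : measurable_fun setT (X j i).
Proof. by case: XN. Qed.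

Let poisN j : poisson_process P (N j).
Proof. by case: XN. Qed.

Let PX j i b : P [set w | X j i w = sgn b] = (1 / 2)%:E.
Proof. by case: XN => _ X1 X2 _ _; case: b. Qed.

Let sgn_inj : injective sgn.
Proof. by move=> [] [] //; rewrite /sgn /=; lra. Qed.

Let mXb j i b : measurable [set w | X j i w = sgn b].
Proof.
have := mX j i measurableT (measurable_set1 (sgn b)).
by rewrite setTI.
Qed.

Let mN t j k : 0 <= t -> measurable [set w | N j t w = k].
Proof.
move=> t0; have [mNt _ _ _] := poisN j.
have := mNt t t0 measurableT _ (measurable_set1 (k%:R : R)).
rewrite setTI; congr measurable; apply/seteqP; split=> w /=.
  by move/eqP; rewrite eqr_nat => /eqP.
by move=> ->.
Qed.

Let N_eq0 j : P [set w | N j s w = 0%N] = (expR (- s))%:E.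
Proof.
have [_ N0 _ /(_ 1%N (fun i => s *+ i) (fun=> 0%N))] := poisN j.
rewrite big_nat1 mulr1n mulr0n subr0 /pois_pmf expr0 fact0 divr1 mul1r => <-//.
  congr (P _); apply/seteqP; split=> w /=.
    by move=> Nw [|//] _ /=; rewrite N0 subn0 mulr1n.
  by move=> /(_ 0%N erefl) /=; rewrite N0 subn0 mulr1n.
by move=> [|//] _; rewrite mulr1n.
Qed.

Definition jump_cyl j k (x : bool * bool) : set T :=
  [set w | [/\ N j s w = k, X j 0 w = sgn x.1 & X j k w = sgn x.2]].

Definition pair_event j (x : bool * bool) : set T :=
  [set w | Xt X N j 0 w = sgn x.1 /\ Xt X N j s w = sgn x.2].

(** At [k = 0] both conditions bear on the same variable; otherwise they bear on two independent
    ones. *)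
Definition jump_cyl_prob j k (x : bool * bool) : R :=
  fine (P [set w | N j s w = k]) *
  (if k == 0%N then (x.1 == x.2)%:R / 2 else 1 / 4).

Lemma measurable_jump_cyl j k x : measurable (jump_cyl j k x).
Proof.
have -> : jump_cyl j k x = [set w | N j s w = k] `&`
    ([set w | X j 0 w = sgn x.1] `&` [set w | X j k w = sgn x.2]).
  by apply/seteqP; split=> w /= [] // ? [].
by apply: measurableI; [apply: mN; exact: ltW|exact: measurableI].
Qed.

Lemma pair_event_bigcup j x : pair_event j x = \bigcup_k jump_cyl j k x.
Proof.
have [_ N0 _ _] := poisN j.
apply/seteqP; split=> w; rewrite /pair_event /Xt /=.
  by rewrite N0 => -[X0 Xs]; exists (N j s w).
by move=> [k _ [<- X0 Xk]]; rewrite N0.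
Qed.

Lemma trivIset_jump_cyl j x : trivIset setT (jump_cyl j ^~ x).
Proof. by move=> k l _ _ [w [[<- _ _] [<- _ _]]]. Qed.

Lemma measurable_pair_event j x : measurable (pair_event j x).
Proof.
rewrite pair_event_bigcup; apply: bigcup_measurable => k _.
exact: measurable_jump_cyl.
Qed.

Lemma P_jump_cyls (J : seq nat) (k : nat -> nat) (x : nat -> bool * bool) :
  uniq J ->
  P (\bigcap_(j in [set` J]) jump_cyl j (k j) (x j)) =
  (\prod_(j <- J) jump_cyl_prob j (k j) (x j))%:E.
Proof.
move=> uJ.
(* [undup] keeps the blocks distinct when [k j = 0]; the intersection in [B] then imposes both
   conditions on the single block. The coordinate 0 of the [inl] blocks is a dummy. *)
pose bl j : seq ((nat * nat) + nat) :=
  inr j :: [seq inl (j, i) | i <- undup [:: 0%N; k j]].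
pose bls := [seq b | j <- J, b <- bl j].
pose cs (b : (nat * nat) + nat) : seq R := if b is inr _ then [:: s] else [:: 0].
pose B (b : (nat * nat) + nat) (_ : R) : set R :=
  match b with
  | inl ji => (if ji.2 == 0%N then [set sgn (x ji.1).1] else setT) `&`
              (if ji.2 == k ji.1 then [set sgn (x ji.1).2] else setT)
  | inr j => [set (k j)%:R]
  end.
have ubls : uniq bls.
  apply: allpairs_uniq_dep => //.
    move=> j _; rewrite /bl cons_uniq map_inj_uniq ?undup_uniq ?andbT//.
      by apply/negP => /mapP[].
    by move=> i i' [].
  move=> _ _ /allpairsPdep[j [b [_ + ->]]] /allpairsPdep[j' [b' [_ + ->]]] /=.
  rewrite !inE => /orP[/eqP->|/mapP[i _ ->]] /orP[/eqP->|/mapP[i' _ ->]] //=.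
    by move=> [->].
  by move=> [-> ->].
have [_ _ _ _ /(_ bls cs B ubls)] := XN.
have mB b c : measurable (B b c).
  case: b => [[j i]|j] /=; last exact: measurable_set1.
  by apply: measurableI; case: ifP => _ //; exact: measurable_set1.
have okcs b c : c \in cs b -> sw_ok b c.
  by case: b => //= j; rewrite inE => /eqP ->; exact: ltW.
move=> /(_ okcs mB); rewrite big_allpairs_dep.
set L := (X in P X = _); set L' := \bigcap_(j in _) _.
have -> : L = L'.
  apply/seteqP; split=> w wL.
    move=> j /= jJ; have wb b : b \in bl j -> {in cs b, forall c, B b c (sw_blocks X N b c w)}.
      move=> bj; apply: (wL b); apply/allpairsPdep; by exists j, b.
    have /= Nk := wb (inr j) (mem_head _ _) s (mem_head _ _).
    have inl_bl i : i \in [:: 0%N; k j] -> inl (j, i) \in bl j.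
      by move=> ik; rewrite /bl in_cons map_f ?mem_undup// orbT.
    have [|X0 _] := wb (inl (j, 0%N)) _ 0 (mem_head _ _).
      by apply: inl_bl; rewrite mem_head.
    have [|_ Xk] := wb (inl (j, k j)) _ 0 (mem_head _ _).
      by apply: inl_bl; rewrite !inE eqxx orbT.
    split.
    - by apply/eqP; rewrite -(eqr_nat R); apply/eqP.
    - by move: X0.
    - by move: Xk; rewrite /= eqxx.
  move=> b /= /allpairsPdep[j [b' [jJ bj ->]]] {b}.
  have [Nk X0 Xk] := wL j jJ.
  move: bj; rewrite inE => /orP[/eqP->|/mapP[i ik ->]] c /=.
    by rewrite inE => /eqP ->; rewrite Nk.
  move=> _; move: ik; rewrite mem_undup !inE => /orP[] /eqP ->; rewrite eqxx; split=> //.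
    by case: eqP => // k0; move: Xk; rewrite -k0.
  by case: eqP => // ->.
move=> ->; rewrite -prodEFin; apply: eq_bigr => j _.
rewrite /bl big_cons big_map /jump_cyl_prob EFinM; congr (_ * _)%E.
  rewrite fineK ?fin_num_measure//; last by apply: mN; exact: ltW.
  congr (P _); apply/seteqP; split=> w /=.
    move=> /(_ s (mem_head _ _)) /= /eqP; rewrite eqr_nat => /eqP //.
  by move=> Nk c /=; rewrite inE => /eqP ->; rewrite Nk.
have XE i : \bigcap_(c in [set` cs (inl (j, i))])
    (sw_blocks X N (inl (j, i)) c @^-1` B (inl (j, i)) c) = X j i @^-1` B (inl (j, i)) 0.
  by apply/seteqP; split=> w /= => [|+ c]; [apply; exact: mem_head|].
rewrite /= inE eq_sym; case: (eqVneq (k j) 0%N) => [k0|k0];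
  rewrite !big_cons big_nil mule1 !XE /=.
  rewrite k0 eqxx; have [->|xx] := eqVneq (x j).1 (x j).2.
    by rewrite setIid -[RHS](PX j 0 (x j).2).
  rewrite mul0r -[RHS](measure0 P); congr (P _); apply/seteqP; split=> w //=.
  by move=> [-> /sgn_inj]; apply/eqP.
rewrite eq_sym (negbTE k0) eqxx setIT setTI.
by rewrite (PX j 0 (x j).1) (PX j (k j) (x j).2) -EFinM; congr EFin; field.
Qed.

Let jump_cyl_prob_ge0 j k x : 0 <= jump_cyl_prob j k x.
Proof.
by rewrite mulr_ge0 ?fine_ge0//; case: ifP => _; rewrite ?divr_ge0 ?ler0n.
Qed.

Let P_jump_cyl j k x : P (jump_cyl j k x) = (jump_cyl_prob j k x)%:E.
Proof.
have := P_jump_cyls (J := [:: j]) (fun=> k) (fun=> x) erefl.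
rewrite big_seq1 => <-; congr (P _).
apply/seteqP; split=> w; first by move=> wk i /=; rewrite inE => /eqP ->.
by apply; exact: mem_head.
Qed.

Let P_pair_event_series j x :
  P (pair_event j x) = (\sum_(0 <= k <oo) (jump_cyl_prob j k x)%:E)%E.
Proof.
rewrite pair_event_bigcup measure_semi_bigcup.
- by apply: eq_eseriesr => k _; exact: P_jump_cyl.
- by move=> k; exact: measurable_jump_cyl.
- exact: trivIset_jump_cyl.
- by rewrite -pair_event_bigcup; exact: measurable_pair_event.
Qed.

(** Without a jump, of probability [expR (- s)], the signs agree; with at least one jump they are
    independent. For equal signs this gives [expR (- s) / 2 + (1 - expR (- s)) / 4]. *)
Lemma P_pair_event j x :
  P (pair_event j x) = (pair_prob (expR (- s)) x)%:E.
Proof.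
pose pi k := fine (P [set w | N j s w = k]).
have piE k : (pi k)%:E = P [set w | N j s w = k].
  by rewrite /pi fineK// fin_num_measure//; apply: mN; exact: ltW.
have pi0 k : (0 <= (pi k)%:E)%E by rewrite piE.
have tail : (\sum_(1 <= k <oo) (pi k)%:E = (1 - expR (- s))%:E)%E.
  have total : (\sum_(0 <= k <oo) (pi k)%:E = 1)%E.
    rewrite -(probability_setT P).
    have -> : [set: T] = \bigcup_k [set w | N j s w = k].
      by apply/esym/seteqP; split=> w // _; exists (N j s w).
    rewrite measure_semi_bigcup.
    - by apply: eq_eseriesr => k _; exact: piE.
    - by move=> k; apply: mN; exact: ltW.
    - by move=> k l _ _ [w [/= <- <-]].
    - by apply: bigcup_measurable => k _; apply: mN; exact: ltW.
  move: total; rewrite nneseries_recl// piE N_eq0 => total.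
  by rewrite EFinB -total addeAC subee// add0e.
rewrite P_pair_event_series nneseries_recl//; last first.
  by move=> k _; rewrite lee_fin.
have -> : (\sum_(1 <= k <oo) (jump_cyl_prob j k x)%:E =
    \sum_(1 <= k <oo) (1 / 4)%:E * (pi k)%:E)%E.
  apply/congr_lim/funext => n; apply: eq_big_nat => -[//|k] _ /=.
  by rewrite -EFinM mulrC.
rewrite nneseriesZl// tail -EFinM -EFinD /jump_cyl_prob N_eq0 /= /pair_prob.
by congr EFin; case: eqP => _ /=; field.
Qed.

(** Factorization is available for cylinders, and a pair event is a countable union of these. The
    induction expands one pair event at a time, moves its index from [J1] to [J2], and sums the
    series. *)
Let P_pair_events_jump_cyls (J1 J2 : seq nat) (k : nat -> nat)
    (x : nat -> bool * bool) : uniq (J1 ++ J2) ->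
  P (\big[setI/setT]_(j <- J1) pair_event j (x j) `&`
     \big[setI/setT]_(j <- J2) jump_cyl j (k j) (x j)) =
  (\prod_(j <- J1) pair_prob (expR (- s)) (x j) *
   \prod_(j <- J2) jump_cyl_prob j (k j) (x j))%:E.
Proof.
elim: J1 J2 k => [|j J1 IH] J2 k uJ.
  by rewrite !big_nil setTI mul1r -bigcap_seq P_jump_cyls.
have [jJ2 uJ'] : j \notin J2 /\ uniq (J1 ++ j :: J2).
  split; first by move: uJ; rewrite cons_uniq mem_cat negb_or => /andP[/andP[]].
  by rewrite -cat1s uniq_catCA.
pose k' i j' := if j' == j then i else k j'.
have cylE i : \big[setI/setT]_(j' <- j :: J2) jump_cyl j' (k' i j') (x j') =
    jump_cyl j i (x j) `&` \big[setI/setT]_(j' <- J2) jump_cyl j' (k j') (x j').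
  rewrite big_cons /k' eqxx; congr (_ `&` _); apply: eq_big_seq => j' j'J2.
  by case: eqP j'J2 => // ->; rewrite (negbTE jJ2).
have prodE i : \prod_(j' <- j :: J2) jump_cyl_prob j' (k' i j') (x j') =
    jump_cyl_prob j i (x j) * \prod_(j' <- J2) jump_cyl_prob j' (k j') (x j').
  rewrite big_cons /k' eqxx; congr (_ * _); apply: eq_big_seq => j' j'J2.
  by case: eqP j'J2 => // ->; rewrite (negbTE jJ2).
rewrite !big_cons -setIA pair_event_bigcup setI_bigcupl.
set A := \big[setI/setT]_(j <- J1) _; set B := \big[setI/setT]_(j <- J2) _.
set a := \prod_(j <- J1) _; set b := \prod_(j <- J2) _.
have mA : measurable A.
  by apply: bigsetI_measurable => i _; exact: measurable_pair_event.
have mB : measurable B.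
  by apply: bigsetI_measurable => i _; exact: measurable_jump_cyl.
have mF i : measurable (jump_cyl j i (x j) `&` (A `&` B)).
  by apply: measurableI; [exact: measurable_jump_cyl|exact: measurableI].
rewrite measure_semi_bigcup//; last first.
- by apply: bigcup_measurable => i _; exact: mF.
- exact/trivIset_setIr/trivIset_jump_cyl.
have ab0 : 0 <= a * b.
  have : (0 <= P (A `&` B))%E by []; rewrite (IH J2 k) ?lee_fin//.
  by move: uJ => /= /andP[].
have -> : (\sum_(0 <= i <oo) P (jump_cyl j i (x j) `&` (A `&` B)) =
    \sum_(0 <= i <oo) (a * b)%:E * (jump_cyl_prob j i (x j))%:E)%E.
  apply: eq_eseriesr => i _.
  by rewrite setICA -cylE IH// prodE -EFinM -/a -/b; congr EFin; ring.
rewrite nneseriesZl; last by move=> i _; rewrite lee_fin.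
rewrite -P_pair_event_series P_pair_event -EFinM.
by congr EFin; ring.
Qed.

(** * From finite sign paths to the law of the two walks *)

Definition path_event (c : seq (bool * bool)) : set T :=
  [set w | forall j, (j < size c)%N ->
    pair_event j.+1 (nth (false, false) c j) w].

Let path_eventE c : path_event c =
  \big[setI/setT]_(j <- iota 1 (size c))
    pair_event j (nth (false, false) c j.-1).
Proof.
rewrite -bigcap_seq; apply/seteqP; split=> w wc j /=.
  by rewrite mem_iota; case: j => // j /andP[_]; exact: wc.
by move=> jc; apply: (wc j.+1); rewrite /= mem_iota.
Qed.

Let measurable_path_event c : measurable (path_event c).
Proof.
rewrite path_eventE; apply: bigsetI_measurable => j _.
exact: measurable_pair_event.
Qed.

Let P_path_event c :
  fine (P (path_event c)) = \prod_(x <- c) pair_prob (expR (- s)) x.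
Proof.
have := @P_pair_events_jump_cyls (iota 1 (size c)) [::] (fun=> 0%N)
  (fun j => nth (false, false) c j.-1).
rewrite cats0 iota_uniq !big_nil setIT -path_eventE mulr1 => ->//=.
rewrite (iotaDl 1 0) big_map [RHS](big_nth (false, false)) /index_iota subn0.
exact: eq_bigr.
Qed.

Let path_event_rcons c x :
  path_event (rcons c x) = path_event c `&` pair_event (size c).+1 x.
Proof.
apply/seteqP; split=> w.
  move=> wc; split=> [j jc|].
    by have := wc j; rewrite size_rcons nth_rcons jc; apply; exact: ltnW.
  by have := wc (size c); rewrite size_rcons nth_rcons ltnn eqxx; apply.
move=> [wc wx] j; rewrite size_rcons nth_rcons ltnS leq_eqVlt.
case: ltngtP => // [jc _|-> _]; [exact: wc|exact: wx].
Qed.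

(** The sign of the last step, that is the running product, together with the position. *)
Definition walk_state (b : seq bool) : bool * int :=
  foldl (fun wz e => (wz.1 (+) e, wz.2 + bsign (wz.1 (+) e))) (false, 0) b.

Let walk_state_rcons b e : walk_state (rcons b e) =
  ((walk_state b).1 (+) e, (walk_state b).2 + bsign ((walk_state b).1 (+) e)).
Proof. by rewrite /walk_state foldl_rcons. Qed.

Let walk_stateP (b : seq bool) t w :
  (forall j, (j < size b)%N -> Xt X N j.+1 t w = sgn (nth false b j)) ->
  \prod_(1 <= j < (size b).+1) Xt X N j t w = sgn (walk_state b).1 /\
  Zsw X N (size b) t w = (walk_state b).2%:~R.
Proof.
elim/last_ind: b => [|b e IH] wb; first by rewrite /Zsw !big_geq.
have [|wE zE] := IH.
  move=> j jb; have := wb j; rewrite size_rcons nth_rcons jb.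
  by apply; exact: ltnW.
have prodE : \prod_(1 <= j < (size b).+2) Xt X N j t w =
    sgn ((walk_state b).1 (+) e).
  rewrite big_nat_recr//= wE.
  have := wb (size b); rewrite size_rcons nth_rcons ltnn eqxx => ->//.
  by rewrite /sgn -intrM; case: (walk_state b).1; case: e {wb}.
rewrite size_rcons walk_state_rcons; split=> //=.
by rewrite /Zsw big_nat_recr//= -/(Zsw X N (size b) t w) zE prodE rmorphD.
Qed.

(** Induction on the number [k] of signs still to be revealed after a prefix [c]. A full path
    decides [A]; a shorter one is split according to the next pair of signs, up to a null set. *)
Lemma P_walks_pairE (n : nat) (G : int -> int -> bool) (A : set T) :
  measurable A ->
  (forall w (z z' : int), Zsw X N n 0 w = z%:~R -> Zsw X N n s w = z'%:~R ->
    A w <-> G z z') ->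
  fine (P A) =
  pairE (expR (- s)) (fun z z' => (G z z')%:R) n false false 0 0.
Proof.
move=> mA AG; set F := fun z z' => _.
pose st1 (c : seq (bool * bool)) := walk_state (unzip1 c).
pose st2 (c : seq (bool * bool)) := walk_state (unzip2 c).
suff main k c : (size c + k = n)%N -> fine (P (A `&` path_event c)) =
    \prod_(x <- c) pair_prob (expR (- s)) x *
    pairE (expR (- s)) F k (st1 c).1 (st2 c).1 (st1 c).2 (st2 c).2.
  rewrite -[A]setIT (_ : setT = path_event [::]); last by apply/esym/seteqP; split.
  by rewrite (main n [::])// big_nil mul1r.
elim: k c => [|k IH] c; rewrite ?addn0 => cn.
  have AF : path_event c `<=` [set w | A w <-> G (st1 c).2 (st2 c).2].
    move=> w wc /=; apply: AG.
      rewrite -cn -(size_map fst c); apply: (walk_stateP _).2 => j; rewrite size_map => jc.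
      by rewrite (nth_map (false, false))//; have [] := wc j jc.
    rewrite -cn -(size_map snd c); apply: (walk_stateP _).2 => j; rewrite size_map => jc.
    by rewrite (nth_map (false, false))//; have [] := wc j jc.
  rewrite /= /F -P_path_event; case: (G _ _) AF => AF.
    rewrite mulr1; congr (fine (P _)); apply/setIidPr => w wc.
    exact/(AF w wc).
  rewrite mulr0 (_ : A `&` _ = set0) ?measure0//.
  by apply/seteqP; split=> w // [Aw wc]; have := (AF w wc).1 Aw.
have eventI x : path_event (rcons c x) `<=` path_event c.
  by rewrite path_event_rcons => w [].
rewrite (measure_fin_partition mA (measurable_path_event c)
  (fun x => measurable_path_event (rcons c x)) eventI).
- rewrite /= mulr_sumr; apply: eq_bigr => x _.
  rewrite IH; last by rewrite size_rcons; lia.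
  rewrite big_rcons /st1 /st2 /unzip1 /unzip2 !map_rcons !walk_state_rcons /=.
  by rewrite mulrA.
- move=> x y _ _ [w []]; rewrite !path_event_rcons => -[_ [x1 x2]] [_ [y1 y2]].
  rewrite [x]surjective_pairing [y]surjective_pairing.
  by congr (_, _); apply: sgn_inj; [rewrite -x1 -y1|rewrite -x2 -y2].
- by rewrite P_path_event big_bool2 !P_path_event !big_rcons /pair_prob /=; field.
Qed.

Let measurable_Xt j t : 0 <= t -> measurable_fun setT (Xt X N j t).
Proof.
move=> t0 _ Y mY; rewrite setTI.
have -> : Xt X N j t @^-1` Y =
    \bigcup_k ([set w | N j t w = k] `&` X j k @^-1` Y).
  apply/seteqP; split=> w /=; first by move=> Yw; exists (N j t w).
  by move=> [k _ [/= Nk Yw]]; rewrite /Xt Nk.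
apply: bigcup_measurable => k _; apply: measurableI; first exact: mN.
by rewrite -[X in measurable X]setTI; exact: mX.
Qed.

Let measurable_Zsw n t : 0 <= t -> measurable_fun setT (Zsw X N n t).
Proof.
move=> t0; apply: measurable_sum => k; apply: measurable_prod => j _.
exact: measurable_Xt.
Qed.

Let measurable_Zsw_gt0 n t : 0 <= t -> measurable [set w | 0 < Zsw X N n t w].
Proof.
move=> t0; have := measurable_Zsw n t0 measurableT (measurable_itv `]0, +oo[).
by rewrite setTI preimage_itvoy.
Qed.

Lemma P_Zsw_gt0_pair n :
  fine (P [set w | 0 < Zsw X N n 0 w /\ 0 < Zsw X N n s w]) =
  pairE (expR (- s)) quadrant n false false 0 0.
Proof.
apply: (@P_walks_pairE n (fun z z' => (0 < z) && (0 < z'))%R).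
  by apply: measurableI; apply: measurable_Zsw_gt0 => //; exact: ltW.
move=> w z z' /= -> ->; rewrite !ltr0z; by split=> /andP.
Qed.

Lemma P_Zsw_gt0 n :
  fine (P [set w | 0 < Zsw X N n 0 w]) =
  pairE (expR (- s)) (fun z _ => (0 < z)%R%:R) n false false 0 0.
Proof.
apply: (@P_walks_pairE n (fun z _ => 0 < z)%R).
  exact: measurable_Zsw_gt0.
by move=> w z z' /= -> _; rewrite ltr0z.
Qed.

End SwitchModel.

(** * Choice of the parameters and passage to the limit *)

Theorem theorem2 (d : measure_display) (T : measurableType d) (R : realType)
    (P : probability T R) (X : nat -> nat -> T -> R) (N : nat -> R -> T -> nat)
    (eps : nat -> R) :
  switch_model P X N ->
  (forall n, (0 < n)%N -> 0 < eps n < 1) ->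
  (fun n => n%:R * eps n) @ \oo --> +oo ->
  (fun n => fine (P [set w | 0 < Zsw X N n 0 w /\ 0 < Zsw X N n (eps n) w])
            - fine (P [set w | 0 < Zsw X N n 0 w]) ^+ 2) @ \oo --> (0 : R).
Proof.
move=> XN eps01 neps; apply/cvgr0Pnorm_lt => e e0.
(* Each of the three terms of [pairE_quadrant] will be at most [e / 4]; the cap 1/2 ensures
   [t ^+ 2 <= 1 / 2]. *)
pose t := Num.min (e / 4) (1 / 2).
have t0 : 0 < t by rewrite lt_min !divr_gt0.
have te : t <= e / 4 by rewrite ge_min lexx.
have t1 : t <= 1 / 2 by rewrite ge_min lexx orbT.
have t2 : t ^+ 2 <= 1 / 2 by nra.
have t4 : 0 < t ^+ 4 by exact: exprn_gt0.
near=> n.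
have n0 : (0 < n)%N by near: n; exact: nbhs_infty_gt.
have nE : (8 / e) ^+ 2 < n%:R by near: n; exact: nbhs_infty_gtr.
have nepsE : 16 / (t ^+ 4 * e) < n%:R * eps n by near: n; move/cvgryPgt: neps; exact.
have /andP[en0 en1] := eps01 n n0.
have rho0 : 0 <= expR (- eps n) by exact: expR_ge0.
(* From [expR (- x) <= 1 / (1 + x)] one gets [1 - expR (- x) >= x / (1 + x)], which is at least
   [x / 2] for [x < 1]. *)
have gap : eps n / 2 <= 1 - expR (- eps n).
  have := expR_ge1Dx (eps n); have := expRxMexpNx_1 (eps n).
  nra.
rewrite (P_Zsw_gt0_pair XN en0) (P_Zsw_gt0 XN en0).
have rho01 : 0 <= expR (- eps n) < 1 by rewrite rho0 /=; lra.
rewrite (le_lt_trans (pairE_quadrant n0 rho01 t0 t2))//.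
have sqrt_le : 2 / Num.sqrt n%:R < e / 4.
  have r0 : 0 < Num.sqrt n%:R :> R by rewrite sqrtr_gt0 ltr0n.
  rewrite ltr_pdivrMr// mulrC -ltr_pdivrMr ?divr_gt0//.
  have -> : 2 / (e / 4) = Num.sqrt ((8 / e) ^+ 2).
    rewrite sqrtr_sqr ger0_norm; last by rewrite divr_ge0// ltW.
    by field; rewrite gt_eqF.
  by rewrite ltr_sqrt// ltr0n.
have var_le : 2 / (t ^+ 4 * ((1 - expR (- eps n)) * n%:R)) < e / 4.
  have nr0 : 0 < n%:R :> R by rewrite ltr0n.
  have gap0 : 0 < 1 - expR (- eps n) by lra.
  rewrite ltr_pdivrMr ?mulr_gt0//.
  move: nepsE; rewrite ltr_pdivrMr ?mulr_gt0// => nepsE.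
  have : t ^+ 4 * e * (n%:R * (eps n / 2)) <=
      t ^+ 4 * e * (n%:R * (1 - expR (- eps n))).
    by rewrite ler_pM2l ?mulr_gt0// ler_pM2l.
  lra.
lra.
Unshelve. all: by end_near.
Qed.
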